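(* Let $k \ge 1$ be an integer, and let $P(k,k)$ denote the probability that the two-player M\&M Game, played with fair coins and with both players starting with $k$ M\&M's, ends in a tie. Then $$P(k,k) \;=\; {}_2F_1(k,k,1;1/4)\,4^{-k}.$$
   Context: The two-player M\&M Game: each of two players starts with a given number of M\&M's (here both start with $k$). In each round $n=1,2,3,\dots$ both players simultaneously toss a fair coin; all tosses (of both players and over all rounds) are independent, each being heads with probability $1/2$. A player who tosses a head eats one of their M\&M's (if they have any left); a player who tosses a tail does not eat. Play continues until no one has any M\&M's left. The game ends in a tie if both players eat their last M\&M in the same round, i.e. if the round in which the first player tosses their $k$-th head equals the round in which the second player tosses their $k$-th head. The Pochhammer symbol is $(a)_n = a(a+1)(a+2)\cdots(a+n-1)$, with $(a)_0 = 1$. The hypergeometric function is $${}_2F_1(a,b,c;x) = \sum_{n=0}^\infty \frac{(a)_n (b)_n x^n}{(c)_n\, n!},$$ where $c$ is not a non-positive integer. *)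

(* Defs.v *)
From HB Require Import structures.
From mathcomp Require Import all_boot all_order all_algebra.
From mathcomp Require Import finmap.
From mathcomp Require Import all_classical all_reals all_analysis.
Set Implicit Arguments.
Unset Strict Implicit.
Unset Printing Implicit Defensive.
Import Order.TTheory GRing.Theory Num.Theory.
Import numFieldNormedType.Exports.
Local Open Scope classical_set_scope.
Local Open Scope ring_scope.

Definition pochhammer (R : pzRingType) (a : R) (n : nat) : R :=
  \prod_(i < n) (a + i%:R).

(* Total in c: only meaningful when c is not a non-positive integer, and when
   the series converges. *)
Definition hyp2F1 (R : realType) (a b c x : R) : R :=
  limn (series (fun n : nat =>
    pochhammer a n * pochhammer b n * x ^+ n / (pochhammer c n * n`!%:R))).

Definition mutually_independent (R : realType)
    (d : measure_display) (T : measurableType d) (P : probability T R)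
    (d' : measure_display) (T' : measurableType d')
    (I : choiceType) (X : I -> T -> T') : Prop :=
  forall (J : {fset I}) (B : I -> set T'),
    (forall i, i \in J -> measurable (B i)) ->
    P (\bigcap_(i in [set` J]) (X i @^-1` B i))
    = (\prod_(i <- J) P (X i @^-1` B i))%E.

(* The coin tosses of one player are given as a function s : nat -> bool,
   true being heads; s n is the toss of round n.+1. *)

(* Truncated subtraction: a player with nothing left eats nothing. *)
Fixpoint mms_left (k : nat) (s : nat -> bool) (n : nat) : nat :=
  if n is m.+1 then (mms_left k s m - s m)%N else k.

Definition eats_last (k : nat) (s : nat -> bool) (n : nat) : Prop :=
  (0 < mms_left k s n)%N /\ mms_left k s n.+1 = 0%N.

Definition tie (k l : nat) (s t : nat -> bool) : Prop :=
  exists n : nat, eats_last k s n /\ eats_last l t n.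

(* Main.v *)
(* The tie happens at round n+1 iff each player tosses exactly k-1 heads in the
   first n rounds and then a head; each player has C(n, k-1) such sequences of
   tosses out of 2^(n+1), so this has probability C(n, k-1)^2 4^-(n+1).  Summing
   over n >= k-1 and substituting n = k-1+m gives the hypergeometric series,
   because (k)_m / m! = C(k-1+m, k-1) and (1)_m = m!. *)
Require Import Defs.
From HB Require Import structures.
From mathcomp Require Import all_boot all_order all_algebra.
From mathcomp Require Import finmap.
From mathcomp Require Import all_classical all_reals all_analysis.
From mathcomp Require Import zify ring.
Import Order.TTheory GRing.Theory Num.Theory.
Import numFieldNormedType.Exports.
Local Open Scope classical_set_scope.
Local Open Scope ring_scope.

Lemma mms_leftE k s n : mms_left k s n = (k - \sum_(i < n) s i)%N.
Proof.
elim: n => [|n IHn] /=; first by rewrite big_ord0 subn0.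
by rewrite big_ord_recr /= IHn subnDA.
Qed.

(** Something left after [n] tosses means at most [k] heads, nothing left one toss later means at
    least [k.+1], and a single toss adds at most one head. *)
Lemma eats_lastP k s n :
  eats_last k.+1 s n <-> (\sum_(i < n) s i)%N = k /\ s n.
Proof.
rewrite /eats_last !mms_leftE big_ord_recr /=.
by case: (s n) => /=; split=> -[]; lia.
Qed.

(** Once nothing is left, all later tosses subtract from zero, so a second last bite is
    impossible. *)
Lemma eats_last_inj k s m n : eats_last k s m -> eats_last k s n -> m = n.
Proof.
wlog lt_mn : m n / (m < n)%N => [hw hm hn|].
  by have [lt_mn|lt_nm|//] := ltngtP m n; [|apply/esym]; exact: hw.
rewrite /eats_last !mms_leftE => -[_ left_m] [+ _].
have /subnKC <- := lt_mn.
by rewrite big_split_ord /= subnDA left_m sub0n.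
Qed.

(* The tosses of one player whose heads during the first [n] rounds are the
   rounds in [A], and who tosses heads in the next round. *)
Definition heads_then_head n (A : {set 'I_n}) (i : nat) : bool :=
  if insub i is Some j then j \in A else true.

Lemma heads_then_head_lt n (A : {set 'I_n}) (i : 'I_n) :
  heads_then_head n A i = (i \in A).
Proof.
rewrite /heads_then_head insubT ?ltn_ord // => lt_in.
by congr (_ \in A); exact/val_inj.
Qed.

Lemma heads_then_head_last n (A : {set 'I_n}) : heads_then_head n A n.
Proof. by rewrite /heads_then_head insubF ?ltnn. Qed.

(** This makes the event a finite union of prescribed toss sequences, indexed by the [k]-subsets of
    ['I_n] and hence counted by a binomial coefficient. *)
Lemma eats_last_pattern k s n :
  eats_last k.+1 s n <->
  exists2 A : {set 'I_n}, #|A| = k &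
    forall i, (i < n.+1)%N -> s i = heads_then_head n A i.
Proof.
rewrite eats_lastP; split=> [[sum_s sn]|[A cardA sA]].
  exists [set i : 'I_n | s i]%SET.
    rewrite -sum_s cardsE -sum1_card big_mkcond /=.
    by apply: eq_bigr => i _; rewrite unfold_in; case: (s i).
  move=> i; rewrite ltnS leq_eqVlt => /predU1P[->|lt_in].
    by rewrite heads_then_head_last.
  by rewrite (heads_then_head_lt _ _ (Ordinal lt_in)) inE.
split; last by rewrite sA // heads_then_head_last.
rewrite -cardA -sum1_card [RHS]big_mkcond /=; apply: eq_bigr => i _.
by rewrite sA 1?ltnS 1?ltnW // heads_then_head_lt; case: (i \in A).
Qed.

Section FairCoins.
Context {R : realType} {d : measure_display} {T : measurableType d}.
Variable P : probability T R.

Lemma fair_coin_preimage1 (X : {RV P >-> bool}) (b : bool) :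
  P (X @^-1` [set true]) = (2^-1)%:E -> P (X @^-1` [set b]) = (2^-1)%:E.
Proof.
move=> fairX; case: b => //.
have -> : X @^-1` [set false] = ~` (X @^-1` [set true]).
  by apply/seteqP; split=> w /=; case: (X w).
rewrite probability_setC ?fairX; last exact: measurable_funPTI.
by rewrite -EFinB; congr (_%:E); rewrite {1}(splitr 1) mul1r addrK.
Qed.

(** Independence splits the probability into one factor per coin, and each factor is 1/2 whichever
    face [g] prescribes. *)
Lemma fair_coins_cylinder (I : choiceType) (X : I -> {RV P >-> bool})
    (J : {fset I}) (g : I -> bool) :
  (forall i, P (X i @^-1` [set true]) = (2^-1)%:E) ->
  mutually_independent P (fun i => X i : T -> bool) ->
  P (\bigcap_(i in [set` J]) (X i @^-1` [set g i])) = (2^-1 ^+ #|` J|)%:E.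
Proof.
move=> fairX indepX; rewrite (indepX J (fun i => [set g i])) //.
under eq_bigr do rewrite fair_coin_preimage1 //.
by rewrite prodEFin big_const_seq count_predT -Monoid.iteropE.
Qed.

Variable toss : 'I_2 -> nat -> {RV P >-> bool}.
Hypothesis toss_fair : forall p n, P (toss p n @^-1` [set true]) = (2^-1)%:E.
Hypothesis toss_indep : mutually_independent P
  (fun j : 'I_2 * nat => (toss j.1 j.2 : T -> bool)).

Definition tie_in_round (k n : nat) : set T :=
  [set w | forall p, eats_last k (fun i => toss p i w) n].

Let tosses_upto (n : nat) : {fset 'I_2 * nat} :=
  [fset j in [seq (p, i) | p <- enum 'I_2, i <- iota 0 n]]%fset.

Let mem_tosses_upto n j : (j \in tosses_upto n) = (j.2 < n)%N.
Proof.
rewrite !inE /=; case: j => p i /=.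
apply/allpairsP/idP => [[[p' i'] /= [_ + [_ ->]]]|lt_in].
  by rewrite mem_iota.
by exists (p, i); rewrite mem_enum mem_iota.
Qed.

Let card_tosses_upto n : #|` tosses_upto n| = n.*2.
Proof.
rewrite card_fseq undup_id ?size_allpairs ?size_enum_ord ?size_iota ?mul2n //.
by apply: allpairs_uniq => [||[? ?] [? ?] _ _ //]; rewrite ?enum_uniq ?iota_uniq.
Qed.

Let cylinder n (q : {ffun 'I_2 -> {set 'I_n}}) : set T :=
  \bigcap_(j in [set` tosses_upto n.+1])
    (toss j.1 j.2 @^-1` [set heads_then_head n (q j.1) j.2]).

Let cylinderP n q w : cylinder n q w <->
  forall p i, (i < n.+1)%N -> toss p i w = heads_then_head n (q p) i.
Proof.
split=> [qw p i lt_in|qw [p i]] /=.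
  by apply: (qw (p, i)); rewrite /= mem_tosses_upto.
by rewrite mem_tosses_upto; exact: qw.
Qed.

Let measurable_cylinder n q : measurable (cylinder n q).
Proof.
apply: fin_bigcap_measurable => [|j _]; first exact: finite_fset.
exact: measurable_funPTI.
Qed.

(** Each player has their own [k]-subset of earlier rounds. Both are packed into one finite
    function, so that counting gives a square. *)
Let patterns (k n : nat) : seq {ffun 'I_2 -> {set 'I_n}} :=
  enum (ffun_on [set A : {set 'I_n} | #|A| == k]%SET).

Let tie_in_round_cylinders k n :
  tie_in_round k.+1 n = \bigcup_(q in [set` patterns k n]) cylinder n q.
Proof.
apply/seteqP; split=> w /= => [tie_w|[q + /cylinderP qw] p].
  have /fin_all_exists2[f cardf fw] := fun p => (eats_last_pattern _ _ _).1 (tie_w p).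
  exists (finfun f) => /=.
    by rewrite mem_enum; apply/ffun_onP => p; rewrite inE ffunE; exact/eqP.
  by apply/cylinderP => p i; rewrite ffunE; exact: fw.
rewrite /= mem_enum => /ffun_onP/(_ p); rewrite inE => /eqP card_q.
by apply/eats_last_pattern; exists (q p) => // i; exact: qw.
Qed.

Lemma measurable_tie_in_round k n : measurable (tie_in_round k.+1 n).
Proof. by rewrite tie_in_round_cylinders; exact: fin_bigcup_measurable. Qed.

(** The event is a disjoint union of C(n,k)^2 cylinders, each of which fixes the 2(n+1) tosses of
    the first n+1 rounds. *)
Lemma prob_tie_in_round k n :
  P (tie_in_round k.+1 n) = ('C(n, k)%:R ^+ 2 * 4 ^- n.+1)%:E.
Proof.
rewrite tie_in_round_cylinders measure_fin_bigcup //=; last first.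
  (* Disjointness: an outcome [w] in both cylinders determines both patterns, since membership of
     [i] in a player's set is read off from toss [i]. *)
  move=> q r _ _ [w [/cylinderP qw /cylinderP rw]].
  apply/ffunP => p; apply/setP => i.
  by rewrite -!heads_then_head_lt -qw 1?ltnS 1?ltnW // -rw // ltnS ltnW.
rewrite -fsbig_seq ?enum_uniq //.
under eq_bigr => q _.
  rewrite (fair_coins_cylinder _ (fun j => toss j.1 j.2)
    _ (fun j => heads_then_head n (q j.1) j.2)) //.
  rewrite card_tosses_upto.
  over.
rewrite sumEFin big_enum /= sumr_const card_ffun_on card_draws !card_ord.
by congr EFin; rewrite -mul2n exprM -[LHS]mulr_natl !exprVn -[4]/((2 ^ 2)%:R) !natrX.
Qed.

Lemma tie_tie_in_round k :
  [set w | tie k k (fun n => toss ord0 n w) (fun n => toss ord_max n w)] =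
  \bigcup_n tie_in_round k n.
Proof.
apply/seteqP; split=> w /= [n].
  move=> [eats0 eats1]; exists n => // p.
  have [->|->] : p = ord0 \/ p = ord_max.
    by case: p => -[|[|m]] // lt2; [left|right]; exact: val_inj.
  - exact: eats0.
  - exact: eats1.
by move=> _ eatsn; exists n; split; exact: eatsn.
Qed.

(** One player suffices: the round of the last bite of player [ord0] is unique. *)
Lemma trivIset_tie_in_round k : trivIset setT (tie_in_round k).
Proof.
move=> m n _ _ [w [wm wn]].
exact: eats_last_inj (wm ord0) (wn ord0).
Qed.

(** Countable additivity over the round of the tie, moved from extended reals to reals by [fine]. *)
Lemma cvg_prob_tie k :
  series (fun n => 'C(n, k)%:R ^+ 2 * 4 ^- n.+1 : R) @ \oo -->
  fine (P (\bigcup_n tie_in_round k.+1 n)).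
Proof.
have mE := measurable_tie_in_round k.
have mU : measurable (\bigcup_n tie_in_round k.+1 n).
  by apply: bigcup_measurable => n _.
have cvgP : (\sum_(0 <= i < n) P (tie_in_round k.+1 i))%E @[n --> \oo] -->
    (fine (P (\bigcup_n tie_in_round k.+1 n)))%:E.
  rewrite fineK ?fin_num_measure //.
  exact: measure_semi_sigma_additive (trivIset_tie_in_round k.+1) mU.
have [_] := (fine_cvgP _ _).1 cvgP.
rewrite (_ : _ \o _ = series (fun n => 'C(n, k)%:R ^+ 2 * 4 ^- n.+1)) //.
apply/funext => n; rewrite seriesEnat /=.
by under eq_bigr do rewrite prob_tie_in_round; rewrite sumEFin.
Qed.
End FairCoins.

Lemma pochhammerS (R : comPzRingType) k n :
  pochhammer (k.+1%:R : R) n = ('C(k + n, k) * n`!)%:R.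
Proof.
rewrite /pochhammer; elim: n => [|n IHn].
  by rewrite big_ord0 addn0 binn.
rewrite big_ord_recr /= IHn -natrD -natrM; congr (_%:R).
(* Multiplying by [k]! turns both sides into factorials, avoiding division in [nat]. *)
apply/eqP; rewrite -(eqn_pmul2l (fact_gt0 k)); apply/eqP.
have e m : (k`! * ('C(k + m, k) * m`!) = (k + m)`!)%N.
  by rewrite -(bin_fact (leq_addr m k)) addKn mulnCA.
by rewrite mulnA e e addnS addSn factS mulnC.
Qed.

(** The terms with [i < k] vanish because C(i,k) = 0; shifting the index by [k] matches the others
    term by term, so already the partial sums agree. *)
Lemma series_binomial_sqr (R : realType) k n :
  series (fun i => 'C(i, k)%:R ^+ 2 * 4 ^- i.+1 : R) (n + k)%N =
  series (fun i => pochhammer k.+1%:R i * pochhammer k.+1%:R i *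
    (1 / 4) ^+ i / (pochhammer 1 i * i`!%:R)) n * 4 ^- k.+1.
Proof.
rewrite !seriesEnat /= (big_cat_nat _ (leq_addl _ _)) //= big_nat_cond.
rewrite big1 => [|i]; last first.
  by case/andP => /andP[_ lt_ik] _; rewrite bin_small // expr0n mul0r.
rewrite add0r -{1}[k]add0n big_addn addnK mulr_suml; apply: eq_bigr => i _.
(* The instance [k = 0] gives (1)_i = i!, so both factors i! of the denominator cancel against the
   numerator. *)
rewrite (pochhammerS R 0) !pochhammerS bin0 mul1n addnC.
have : i`!%:R != 0 :> R by rewrite pnatr_eq0 -lt0n fact_gt0.
rewrite natrM div1r exprVn -addSn exprD invfM.
move: (i`!%:R) ('C(_, _)%:R) (4 ^- i) (4 ^- k.+1) => f c x y f0.
by field.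
Qed.

Theorem theorem6p1 (R : realType)
    (d : measure_display) (T : measurableType d) (P : probability T R)
    (toss : 'I_2 -> nat -> {RV P >-> bool})
    (toss_fair : forall (p : 'I_2) (n : nat),
       P (toss p n @^-1` [set true]) = (2^-1)%:E)
    (toss_indep : mutually_independent P
       (fun j : 'I_2 * nat => (toss j.1 j.2 : T -> bool)))
    (k : nat) (k_ge1 : (1 <= k)%N) :
  P [set w | tie k k (fun n => toss ord0 n w) (fun n => toss ord_max n w)]
  = (hyp2F1 (k%:R : R) (k%:R : R) 1 (1 / 4) * 4 ^- k)%:E.
Proof.
case: k k_ge1 => // k _; rewrite tie_tie_in_round.
have mU : measurable (\bigcup_n tie_in_round P toss k.+1 n).
  by apply: bigcup_measurable => n _; exact: measurable_tie_in_round.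
rewrite -[LHS]fineK ?fin_num_measure //; congr (_%:E).
have nz4 : 4 ^+ k.+1 != 0 :> R by rewrite expf_neq0 // pnatr_eq0.
have := cvg_prob_tie P toss toss_fair toss_indep k.
(* Dropping the first [k] partial sums keeps the limit; multiplying by 4^(k+1) then leaves exactly
   the hypergeometric partial sums, whose limit is [hyp2F1]. *)
rewrite -(cvg_shiftn k) => cvg_tie.
have {}cvg_tie := cvgM cvg_tie (cvg_cst (4 ^+ k.+1 : R^o)).
apply: (canRL (mulfK nz4)); apply/esym/cvg_lim => //.
set hyp_series := series _; move: cvg_tie.
rewrite (_ : _ \* _ = hyp_series).
  by move=> cvg_tie; exact: cvg_tie.
by apply/funext => n; rewrite /= series_binomial_sqr mulfVK.
Qed.
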